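(* Let $n\geq 4$ and let $\mathcal{T}_n$ denote the set of trees on $n$ vertices. If $T\in\mathcal{T}_n$ and $T$ is not isomorphic to the balanced double star $S_{\lfloor\frac{n-2}{2}\rfloor,\lceil\frac{n-2}{2}\rceil}$, then $T$ is not maximal with respect to $e^{M_2}$ over $\mathcal{T}_n$, i.e., there exists $T''\in\mathcal{T}_n$ with $e^{M_2}(T'')>e^{M_2}(T)$.
   Context: For a tree (graph) $G$ with edge set $E(G)$ and vertex degrees $d_G(v)$, the exponential of the second Zagreb index is $e^{M_2}(G)=\sum_{uv\in E(G)} e^{d_G(u)d_G(v)}$. For integers $x,y\geq 1$, the double star $S_{x,y}$ is the tree on $x+y+2$ vertices with exactly two non-pendent vertices, of degrees $x+1$ and $y+1$ (these two vertices are adjacent, the first has $x$ pendant neighbours and the second has $y$ pendant neighbours). *)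

(* Defs.v *)
From HB Require Import structures.
From mathcomp Require Import all_boot all_order all_algebra.
From mathcomp Require Import fingroup perm.
From mathcomp Require Import reals.
From mathcomp.analysis Require Import sequences exp.
Set Implicit Arguments. Unset Strict Implicit. Unset Printing Implicit Defensive.
Import Order.TTheory GRing.Theory Num.Theory.

Definition simple_graph (n : nat) (e : rel 'I_n) : Prop :=
  symmetric e /\ irreflexive e.

Definition connected_graph (n : nat) (e : rel 'I_n) : Prop :=
  forall x y : 'I_n, connect e x y.

Definition acyclic (n : nat) (e : rel 'I_n) : Prop :=
  forall c : seq 'I_n, 3 <= size c -> ~ ucycle e c.

Definition is_tree (n : nat) (e : rel 'I_n) : Prop :=
  simple_graph e /\ connected_graph e /\ acyclic e.

Definition deg (n : nat) (e : rel 'I_n) (v : 'I_n) : nat := #|[set u | e v u]|.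

Definition eM2 (R : realType) (n : nat) (e : rel 'I_n) : R :=
  (\sum_(u : 'I_n) \sum_(v : 'I_n | (u < v)%N && e u v)
      expR ((deg e u * deg e v)%:R))%R.

(* the double star S_{x, n-2-x} on vertex set 'I_n: centres 0 and 1 adjacent,
   vertices 2..x+1 pendant at 0, vertices x+2..n-1 pendant at 1 *)
Definition dstar_edge (x : nat) (a b : nat) : bool :=
  [|| (a == 0) && (b == 1),
      (a == 0) && (2 <= b <= x.+1)
    | (a == 1) && (x.+2 <= b)].

Definition dstar (n x : nat) : rel 'I_n :=
  fun u v => dstar_edge x u v || dstar_edge x v u.

Definition graph_iso (n : nat) (e1 e2 : rel 'I_n) : Prop :=
  exists f : {perm 'I_n}, forall u v : 'I_n, e1 u v = e2 (f u) (f v).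

(* Main.v *)
(** Adjacent vertices of a tree have disjoint neighbourhoods, so their degrees
    add up to at most n.  If the sum is less than n on every edge, each term
    of the index is smaller than the central term of the balanced double star by
    a factor at least e^(n/2), which outweighs the n - 1 edges.  Otherwise the
    two neighbourhoods cover the tree, which is thus a double star (or a star,
    the case x = 0), and moving a pendant vertex towards the smaller side
    increases the index. *)

Require Import Defs.
From HB Require Import structures.
From mathcomp Require Import all_boot all_order all_algebra.
From mathcomp Require Import fingroup perm.
From mathcomp Require Import reals.
From mathcomp.analysis Require Import sequences exp.
From mathcomp Require Import zify lra.
Set Implicit Arguments.
Unset Strict Implicit.
Unset Printing Implicit Defensive.
Import Order.TTheory GRing.Theory Num.Theory.

(** * Moving a pendant vertex towards the smaller side of a double star *)

Section DoubleStarWeight.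
Local Open Scope ring_scope.
Variables (F : realFieldType) (E : F).
Hypothesis E_gt2 : 2 < E.

Definition dstar_weight (x y : nat) : F :=
  E ^+ (x.+1 * y.+1) + x%:R * E ^+ x.+1 + y%:R * E ^+ y.+1.

Lemma ler_natr_expr (a b : nat) : (a <= 2 ^ b)%N -> a%:R <= E ^+ b.
Proof.
move=> le_a; apply: le_trans (_ : (2 ^ b)%:R <= _); first by rewrite ler_nat.
by rewrite natrX lerXn2r ?nnegrE ?ler0n ?(ltW E_gt2) // ltW ?(lt_trans _ E_gt2).
Qed.

(* dstar_weight (expR 1) x y is the index of S_{x,y}; only e > 2 matters. *)
Lemma dstar_weight_lt (x k : nat) :
  dstar_weight x (x + k).+2 < dstar_weight x.+1 (x + k).+1.
Proof.
have E_gt0 j : 0 < E ^+ j by rewrite exprn_gt0 // (lt_trans _ E_gt2) ?ltr0n.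
have E2 := E_gt2; have E_ge1 : 1 <= E by lra.
rewrite /dstar_weight; case: x => [|x].
  case: k => [|k].
    (* The gain is exactly [E^2 (E - 1) (E - 2)]. *)
    rewrite !add0n !mul1n mul0r addr0 mul1r.
    have -> : (2 * 2 = 4)%N by [].
    have : 0 < E ^+ 2 * ((E - 1) * (E - 2)) by rewrite !mulr_gt0 //; lra.
    by rewrite !exprS expr0; lra.
  rewrite !add0n !mul1n mul0r addr0 mul1r.
  (* The star weighs [(k + 4) E^(k+4)] in all, and the new central term alone is
     [E^(k+4) E^(k+2)]. *)
  have le_k : k.+4%:R <= E ^+ k.+2.
    apply: ler_natr_expr; elim: k => // k IHk; rewrite expnS; lia.
  have -> : (2 * k.+3 = k.+4 + k.+2)%N by lia.
  have := ler_wpM2l (ltW (E_gt0 k.+4)) le_k; rewrite -exprD => le_EE.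
  have : 0 <= k.+2%:R * E ^+ k.+3 by rewrite mulr_ge0 ?ler0n ?ltW.
  have := E_gt0 2; rewrite -(@natr1 F k.+3) in le_EE *; lra.
(* The central degrees [p], [q] become [p + 1], [q - 1], and the central exponent grows by [k + 1].
   The new central term thus exceeds two old ones: one stands for the old central term, the other
   absorbs the pendant edges at the vertex of degree [q]. *)
set p := x.+2; set q := (x.+1 + k).+3.
have -> : ((x.+1 + k).+2 = q.-1)%N by [].
have le_q : q.-1%:R * E ^+ q <= E ^+ (p * q).
  have -> : (p * q = q + (q + x * q))%N by rewrite /p; lia.
  rewrite exprD mulrC ler_wpM2l ?(ltW (E_gt0 _)) //; apply: ler_natr_expr.
  apply: leq_trans (leq_pred q) (leq_trans (ltnW (ltn_expl q (isT : 1 < 2)%N)) _).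
  by rewrite leq_pexp2l ?leq_addr.
have le_pq : 2 * E ^+ (p * q) <= E ^+ (p.+1 * q.-1).
  have -> : (p.+1 * q.-1 = (1 + k) + p * q)%N by rewrite /p /q /=; nia.
  rewrite (exprD _ (1 + k)) ler_wpM2r ?(ltW (E_gt0 _)) // exprD expr1.
  have : 1 <= E ^+ k by rewrite exprn_ege1.
  nra.
have lt_p : x.+1%:R * E ^+ p < x.+2%:R * E ^+ p.+1.
  apply: le_lt_trans (_ : x.+1%:R * E ^+ p.+1 < _).
    by rewrite ler_wpM2l ?ler0n // ler_weXn2l.
  by rewrite ltr_pM2r ?E_gt0 // ltr_nat.
have : 0 <= (x.+1 + k).+1%:R * E ^+ q.-1 by rewrite mulr_ge0 ?ler0n ?ltW.
by rewrite -/p -/q in lt_p *; lra.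
Qed.

End DoubleStarWeight.

(** * Edge counts and neighbourhoods in trees *)

Section Trees.
Variables (n : nat) (e : rel 'I_n).
Implicit Types (u v w : 'I_n) (S : {set 'I_n}).
Hypothesis tree_e : is_tree e.

Let sym_e : symmetric e. Proof. by case: tree_e => [[]]. Qed.
Let irr_e : irreflexive e. Proof. by case: tree_e => [[]]. Qed.
Let acy_e : acyclic e. Proof. by case: tree_e => [_ []]. Qed.

(** The subgraph induced on [S] has no cycle, so it has a vertex of degree at most 1. Ranging over
    all [S] permits induction by deleting vertices without building subgraphs. *)
Lemma tree_leaf_in S :
  S != set0 -> exists2 x, x \in S & \sum_(y in S) e x y <= 1.
Proof.
case/set0Pn => z Sz.
case: (boolP [exists x in S, \sum_(y in S) e x y <= 1]) => [/exists_inP //|].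
rewrite negb_exists_in => /forall_inP deg2; exfalso.
(* With all degrees at least 2 in S and no cycle, paths extend forever. *)
have longpath k : exists x s, [/\ size s = k, uniq (x :: s), path e x s
    & {subset x :: s <= S}].
  elim: k => [|k [x [s [sz_s uniq_s path_s sub_s]]]].
    by exists z, [::]; split=> // y; rewrite inE => /eqP->.
  have Sx : x \in S by rewrite sub_s ?mem_head.
  (* The path grows at its front, and [head x s] is the vertex visited just before [x]. When [s] is
     empty the default [x] excludes no neighbour. *)
  have [y /andP[Sy exy] ys] : exists2 y, (y \in S) && e x y & y != head x s.
    apply/exists_inP; apply: contraNT (deg2 x Sx).
    rewrite negb_exists_in => /forall_inP hd.
    rewrite (bigID (pred1 (head x s))) /= [X in _ + X]big1 ?addn0.
      rewrite -big_mkcondr /= big_mkcond (bigD1 (head x s)) //= big1 ?addn0.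
        by case: ifP => // _; case: (e x _).
      by move=> i /negPf ->; rewrite andbF.
    move=> i /andP[Si ni]; case exi: (e x i) => //.
    by have := hd i; rewrite Si exi (negPf ni) => /(_ isT).
  have [ys'|nys] := boolP (y \in s).
    case/splitPr: ys' uniq_s path_s ys => s1 s2.
    (* As [y] is not the head of [s], some vertex lies between [x] and [y], and the edge [x y]
       closes a cycle of length at least 3. *)
    case: s1 => [|a s1]; first by rewrite /= eqxx.
    rewrite -cat_rcons -cat_cons cat_uniq cat_path => /andP[us _] /andP[ps _] _.
    exfalso; apply: (@acy_e (x :: rcons (a :: s1) y)); first by rewrite /= size_rcons.
    by rewrite /ucycle us andbT /path.cycle rcons_path ps last_rcons sym_e exy.
  exists y, (x :: s); split; rewrite /= ?sz_s //.
  - rewrite inE negb_or nys andbT; move: uniq_s => /= ->; rewrite andbT.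
    by apply: contraTneq exy => ->; rewrite irr_e.
  - by rewrite sym_e exy.
  - by move=> w; rewrite inE => /predU1P[->|/sub_s].
have [x [s [sz uniq_s _ _]]] := longpath n.
by have := max_card (mem (x :: s)); rewrite (card_uniqP uniq_s) /= sz card_ord ltnn.
Qed.

(** The double sum counts each edge inside [S] twice. Deleting the vertex given by [tree_leaf_in]
    removes at most one edge, so the sum drops by at most 2. *)
Lemma tree_sum_in S : S != set0 ->
  \sum_(x in S) \sum_(y in S) e x y <= (#|S|.-1).*2.
Proof.
elim: {S}#|S| {-2}S (erefl #|S|) => [|k IHk] S cardS S0.
  by rewrite -cards_eq0 cardS in S0.
have [x Sx degx] := tree_leaf_in S0.
have cardSx : #|S :\ x| = k by move: (cardsD1 x S); rewrite Sx cardS => -[].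
have split_x (G : 'I_n -> nat) : \sum_(y in S) G y = G x + \sum_(y in S :\ x) G y.
  by rewrite (big_setD1 x).
have degSx : \sum_(y in S) e x y = \sum_(y in S :\ x) e y x.
  by rewrite split_x irr_e; apply: eq_bigr => y _; rewrite sym_e.
have -> : \sum_(a in S) \sum_(y in S) e a y =
    (\sum_(y in S) e x y).*2 + \sum_(a in S :\ x) \sum_(y in S :\ x) e a y.
  rewrite split_x -addnn -addnA {3}degSx -big_split.
  by congr (_ + _); apply: eq_bigr => a _; rewrite (split_x (fun y => e a y)).
have [Sx0|Sx0] := eqVneq (S :\ x) set0; first by rewrite degSx Sx0 !big_set0.
have := IHk _ cardSx Sx0; have : 0 < #|S :\ x| by rewrite card_gt0.
rewrite cardS cardSx; lia.
Qed.

Lemma tree_adj_neq u v : e u v -> u != v.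
Proof. by apply: contraTneq => ->; rewrite irr_e. Qed.

Lemma degE u : deg e u = \sum_v e u v.
Proof. by rewrite /deg cardsE -sum1_card big_mkcond. Qed.

(** A common neighbour would close a triangle. *)
Lemma tree_neighbours_disjoint u v :
  e u v -> [disjoint [set w | e u w] & [set w | e v w]].
Proof.
move=> euv; rewrite disjoint_subset; apply/subsetP => w; rewrite !inE => euw.
apply/negP => evw; apply: (@acy_e [:: u; v; w]) => //.
rewrite /ucycle /= euv evw sym_e euw /= !inE negb_or !andbT.
by rewrite !tree_adj_neq.
Qed.

Lemma tree_deg_add_le u v : e u v -> deg e u + deg e v <= n.
Proof.
move=> /tree_neighbours_disjoint /disjoint_setI0 disj.
by rewrite /deg -cardsUI disj cards0 addn0 -[leqRHS]card_ord max_card.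
Qed.

End Trees.

(** Each vertex is adjacent to exactly one of [u] and [v], and an edge avoiding both would close a
    triangle or a 4-cycle. Only the edges of a double star remain. *)
Lemma tree_spanning_dstar n (e : rel 'I_n) (u v : 'I_n) :
    is_tree e -> e u v -> deg e u + deg e v = n ->
  graph_iso e (@dstar n (deg e u).-1).
Proof.
move=> tree_e euv deg_uv; have [[sym_e irr_e] [_ acy_e]] := tree_e.
have neq_uv : u != v by apply: contraTneq euv => ->; rewrite irr_e.
pose A := [set w | e u w] :\ v; pose B := [set w | e v w] :\ u.
have cardA : size (enum A) = (deg e u).-1.
  by rewrite -cardE /deg (cardsD1 v [set w | e u w]) inE euv.
have disj := tree_neighbours_disjoint tree_e.
(* Disjoint neighbourhoods with [n] elements in total fill the vertex set. *)
have cover w : e u w || e v w.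
  have: w \in [set w | e u w] :|: [set w | e v w].
    suff -> : [set w | e u w] :|: [set w | e v w] = setT by rewrite inE.
    apply/eqP; rewrite eqEcard subsetT cardsT card_ord cardsU.
    by rewrite (disjoint_setI0 (disj _ _ euv)) cards0 subn0 -/(deg e u) -/(deg e v) deg_uv /=.
  by rewrite !inE.
have nodisj a b w : e a b -> e a w -> e b w -> False.
  move=> eab eaw ebw; have /pred0P/(_ w) := disj _ _ eab.
  by rewrite /= !inE eaw ebw.
have inAB w : w != u -> w != v -> (w \in A) = (w \notin B).
  move=> wu wv; rewrite !inE wu wv /=; have := cover w.
  have := @nodisj u v w euv; case: (e u w) (e v w) => [] [] //= H; by case: H.
(* The isomorphism sends a vertex to its position in [s], so [A] and [B] fill exactly the two ranges
   of pendant labels in [dstar_edge]. *)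
pose s := u :: v :: enum A ++ enum B.
pose f (w : 'I_n) := index w s.
have f0 w : (f w == 0) = (w == u).
  by rewrite /f /= (eq_sym u); case: (w == u).
have f1 w : (f w == 1) = (w == v).
  rewrite /f /= (eq_sym u) (eq_sym v); have [->|_] := eqVneq w u.
    by rewrite (negPf neq_uv).
  by case: (w == v).
have fu : f u = 0 by apply/eqP; rewrite f0.
have fv : f v = 1 by apply/eqP; rewrite f1.
have f2 w : w != u -> w != v -> f w = (index w (enum A ++ enum B)).+2.
  by rewrite /f /= (eq_sym u) (eq_sym v) => /negPf -> /negPf ->.
have fA w : (2 <= f w <= (deg e u).-1.+1) = (w \in A).
  have [->|wu] := eqVneq w u.
    by rewrite fu !inE irr_e andbF.
  have [->|wv] := eqVneq w v.
    by rewrite fv !inE eqxx.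
  rewrite f2 //= index_cat mem_enum -cardA; case: ifP => wA.
    by rewrite !ltnS index_mem mem_enum.
  by rewrite !ltnS -[X in _ <= X]addn0 -addnS leq_add2l.
have fB w : ((deg e u).-1.+2 <= f w) = (w \in B).
  have [->|wu] := eqVneq w u.
    by rewrite fu !inE eqxx.
  have [->|wv] := eqVneq w v.
    by rewrite fv !inE irr_e andbF.
  have /= := fA w; rewrite f2 //= !ltnS ltnNge inAB // => /negbRL.
  by rewrite negbK.
have mem_s w : w \in s.
  rewrite !inE mem_cat !mem_enum; case: eqVneq => //= wu; case: eqVneq => //= wv.
  by rewrite inAB // orNb.
have uniq_s : uniq s.
  rewrite /= !inE negb_or neq_uv !mem_cat !mem_enum cat_uniq !enum_uniq andbT /=.
  rewrite !inE !irr_e !eqxx !andbF /=.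
  apply/hasPn => w; rewrite !mem_enum !inE => /andP[_ evw].
  by apply/negP => /andP[_ euw]; exact: nodisj euv euw evw.
have size_s : size s = n.
  rewrite -(card_uniqP uniq_s) -[RHS]card_ord; apply: eq_card => w.
  by rewrite mem_s.
have f_lt w : f w < n by rewrite -size_s index_mem.
have f_inj : injective (fun w => Ordinal (f_lt w)).
  by move=> a b /(congr1 val) /= /(congr1 (nth u s)); rewrite !nth_index.
exists (perm f_inj) => a b; rewrite !permE /dstar /dstar_edge /= !f0 !f1 !fA !fB.
have [->|au] := eqVneq a u.
  rewrite (negPf neq_uv) !inE !irr_e !eqxx /= !andbF !orbF.
  by have [->|] := eqVneq b v; rewrite ?euv.
have [->|bu] := eqVneq b u.
  rewrite (negPf neq_uv) !inE !irr_e !eqxx /= !andbF orbF sym_e.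
  by have [->|] := eqVneq a v; rewrite ?euv.
have [->|av] := eqVneq a v; have [->|bv] := eqVneq b v => /=;
  rewrite ?irr_e ?orbF ?inE ?irr_e ?au ?bu ?andbF //=.
apply/negP => eab.
have nocycle4 c d : e u c -> e v d -> c != v -> d != u -> e c d -> False.
  move=> euc evd cv du ecd; apply: (acy_e [:: u; c; d; v]) => //.
  rewrite /ucycle /= euc ecd sym_e evd sym_e euv /= !inE !negb_or !andbT.
  have cd : c != d by apply: contraTneq ecd => ->; rewrite irr_e.
  have uc : u != c by apply: contraTneq euc => ->; rewrite irr_e.
  have dv : d != v by apply: contraTneq evd => ->; rewrite irr_e.
  by rewrite uc cd dv cv neq_uv (eq_sym u) du.
have [/orP[eua|eva] /orP[eub|evb]] := (cover a, cover b).
- exact: nodisj eua eub eab.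
- exact: nocycle4 eua evb av bu eab.
- by apply: (nocycle4 b a) => //; rewrite sym_e.
- exact: nodisj eva evb eab.
Qed.

(** * Invariance of the index under isomorphism *)

Section eM2Sums.
Local Open Scope ring_scope.
Variables (R : realType) (n : nat).
Implicit Types e : rel 'I_n.

(** The condition [u < v] in [eM2] is not preserved by relabelling; the sum over ordered pairs is
    symmetric and can be reindexed. *)
Lemma eM2_double e : simple_graph e ->
  eM2 R e *+ 2 =
    \sum_u \sum_(v | e u v) expR ((deg e u * deg e v)%:R).
Proof.
case=> sym_e irr_e; rewrite mulr2n [in X in _ + X]/eM2 /eM2.
rewrite [X in _ + X](exchange_big_dep xpredT) //= -big_split /=.
apply: eq_bigr => u _; rewrite [RHS](bigID (fun v : 'I_n => (u < v)%N)) /=.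
congr (_ + _); first by apply: eq_bigl => v; rewrite andbC.
apply: eq_big => [v|v _]; last by rewrite mulnC.
rewrite sym_e andbC -leqNgt; case euv: (e u v); rewrite ?andbF //=.
rewrite ltn_neqAle; case: eqP => // /val_inj eq_vu.
by rewrite eq_vu irr_e in euv.
Qed.

Lemma eM2_iso e1 e2 : simple_graph e1 -> simple_graph e2 ->
  graph_iso e1 e2 -> eM2 R e1 = eM2 R e2.
Proof.
move=> simple1 simple2 [f f_iso].
have deg_f u : deg e2 (f u) = deg e1 u.
  rewrite !degE (reindex_inj (@perm_inj _ f)) /=.
  by apply: eq_bigr => v _; rewrite f_iso.
apply: (@pmulrnI _ 2) => //; rewrite !eM2_double //.
rewrite [RHS](reindex_inj (@perm_inj _ f)) /=; apply: eq_bigr => u _.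
rewrite [RHS](reindex_inj (@perm_inj _ f)) /=.
by apply: eq_big => v; rewrite ?f_iso // !deg_f.
Qed.

End eM2Sums.

(** * Double stars are trees, and their index *)

Section DoubleStar.
Variables x y : nat.
Local Notation ds := (@dstar (x + y).+2 x).
Let c0 : 'I_(x + y).+2 := ord0.
Let c1 : 'I_(x + y).+2 := lift ord0 ord0.
(** The pendant vertices take the form that [big_ord_recl] and [big_split_ord] produce. *)
Let pendant0 (i : 'I_x) : 'I_(x + y).+2 := lift ord0 (lift ord0 (lshift y i)).
Let pendant1 (j : 'I_y) : 'I_(x + y).+2 := lift ord0 (lift ord0 (rshift x j)).

Ltac dstar_lia :=
  rewrite /dstar /dstar_edge ?/c0 ?/c1 ?/pendant0 ?/pendant1 /= /bump /=; lia.

Lemma big_dstar (V : Type) (idx : V) (op : Monoid.law idx) (G : 'I_(x + y).+2 -> V) :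
  \big[op/idx]_v G v =
    op (G c0) (op (G c1) (op (\big[op/idx]_i G (pendant0 i))
                            (\big[op/idx]_j G (pendant1 j)))).
Proof. by rewrite !big_ord_recl big_split_ord. Qed.

Lemma dstar_is_tree : is_tree ds.
Proof.
have sym_ds : symmetric ds by move=> u v; rewrite /dstar orbC.
split; [split=> // | split].
- move=> u; rewrite /dstar /dstar_edge; lia.
- have conn0 w : connect ds c0 w.
    have [w0|w0] := eqVneq (w : nat) 0.
      by rewrite (_ : w = c0) //; apply: val_inj.
    have [w1|w1] := leqP w x.+1.
      apply: connect1; dstar_lia.
    apply: (@connect_trans _ _ c1); apply: connect1;
      dstar_lia.
  move=> u v; apply: connect_trans (conn0 v).
  by rewrite (sym_connect_sym sym_ds) conn0.
move=> c size_c /andP[cycle_c uniq_c].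
(* Rotate the cycle to start at [w]. If [w] were pendant, its successor [a] and its predecessor
   [last b t] would both be its only neighbour, against uniqueness. Hence a cycle has at most two
   vertices. *)
have: {subset c <= [:: c0; c1]}.
  move=> w /rot_to[i [|a [|b t]] rot_c]; move: (size_rot i c); rewrite rot_c /=; try lia.
  move: cycle_c uniq_c; rewrite -(rot_cycle i) -(rot_uniq i) rot_c /=.
  rewrite rcons_path => /and4P[dwa _ _ dlw] /and3P[_ /negP a_bt _] _.
  rewrite !inE -!val_eqE /=; apply/negPn/negP => w_leaf; apply: a_bt.
  rewrite (_ : a = last b t) ?mem_last //; apply: val_inj.
  move: dwa dlw w_leaf; dstar_lia.
by move/(uniq_leq_size uniq_c) => /=; lia.
Qed.

Lemma eM2_dstar (R : realType) : eM2 R ds = dstar_weight (expR 1%R) x y.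
Proof.
have ltx (i : 'I_x) := ltn_ord i.
have ds0A i : ds c0 (pendant0 i) by have := ltx i; dstar_lia.
have ds0B j : ds c0 (pendant1 j) = false by dstar_lia.
have ds1A i : ds c1 (pendant0 i) = false by have := ltx i; dstar_lia.
have ds1B j : ds c1 (pendant1 j) by dstar_lia.
have deg0 : deg ds c0 = x.+1.
  rewrite degE big_dstar /= (eq_bigr (fun=> 1)) => [|i _]; last by rewrite ds0A.
  rewrite [X in _ + (_ + (_ + X))]big1 => [|j _]; last by rewrite ds0B.
  by rewrite sum_nat_const card_ord muln1 addn0.
have deg1 : deg ds c1 = y.+1.
  rewrite degE big_dstar /= big1 => [|i _]; last by rewrite ds1A.
  rewrite (eq_bigr (fun=> 1)) => [|j _]; last by rewrite ds1B.
  by rewrite sum_nat_const card_ord muln1.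
have degA i : deg ds (pendant0 i) = 1.
  have lt_i := ltx i; rewrite degE big_dstar /= !big1 => [|j _|j _].
  - by dstar_lia.
  - by dstar_lia.
  - by have := ltx j; dstar_lia.
have degB j : deg ds (pendant1 j) = 1.
  rewrite degE big_dstar /= !big1 => [|i _|i _].
  - by dstar_lia.
  - by dstar_lia.
  - by have := ltx i; dstar_lia.
have expE k : expR (k%:R : R) = (expR 1 ^+ k)%R by rewrite -expRM_natl mulr1.
rewrite /eM2 big_dstar /=.
(* Each edge is counted at its smaller end, which is a centre, so the rows of pendant vertices
   vanish. *)
rewrite [X in (_ + (_ + (X + _)))%R]big1 => [|i _]; last first.
  by rewrite big_pred0 // => v; have := ltx i; dstar_lia.
rewrite [X in (_ + (_ + (_ + X)))%R]big1 => [|j _]; last first.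
  by rewrite big_pred0 // => v; dstar_lia.
rewrite [X in (X + _)%R]big_mkcond [X in (_ + (X + _))%R]big_mkcond !big_dstar /=.
rewrite (eq_bigr (fun=> expR 1 ^+ x.+1)%R) => [|i _]; last first.
  by rewrite ds0A /= deg0 degA muln1 expE.
rewrite [X in (_ + (_ + (_ + X)) + _)%R]big1 => [|j _]; last by rewrite ds0B.
rewrite [X in (_ + (_ + (_ + (X + _)) + _))%R]big1 => [|i _]; last by rewrite ds1A.
rewrite [X in (_ + (_ + (_ + (_ + X)) + _))%R](eq_bigr (fun=> expR 1 ^+ y.+1)%R)
  => [|j _]; last first.
  by rewrite ds1B deg1 degB muln1 expE.
rewrite !sumr_const !card_ord deg0 deg1 expE /dstar_weight !mulr_natl.
by rewrite !addr0 !add0r.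
Qed.

End DoubleStar.

(** * Comparing the index of a tree with that of double stars *)

Lemma leq_mul_balanced (p q a b : nat) :
  a <= b.+1 -> b <= a.+1 -> p + q <= a + b -> p * q <= a * b.
Proof.
(* Near equality of [a] and [b] puts one factor below both. With [a = p + c] and [b = p + d], [q] is
   at most [p + c + d], and [p (p + c + d)] is [a b - c d]. *)
wlog /andP[le_pa le_pb] : p q / (p <= a) && (p <= b) => [le_mul | _ _ le_pq].
  move=> ab ba pq; case: (boolP ((p <= a) && (p <= b))) => [p_le | p_gt].
    exact: le_mul.
  by rewrite mulnC; apply: le_mul; lia.
rewrite -(subnKC le_pa) -(subnKC le_pb) in le_pq *.
by move: (a - p) (b - p) le_pq => c d; nia.
Qed.

Section Comparison.
Variable R : realType.
Local Open Scope ring_scope.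

Lemma expR1_gt2 : 2 < expR 1 :> R.
Proof. by rewrite -[2]/(1 + 1); apply: expR_gt1Dx; rewrite oner_eq0. Qed.

Lemma eM2_dstar_lt (n x : nat) : (x < (n - 2)./2)%N ->
  eM2 R (@dstar n x) < eM2 R (@dstar n x.+1).
Proof.
(* The other side has at least two more pendant vertices; [k] is the excess over two. *)
move=> lt_x; have [k ->] : exists k, n = (x + (x + k).+2).+2.
  by exists (n - 4 - x.*2)%N; lia.
rewrite eM2_dstar (_ : (x + (x + k).+2 = x.+1 + (x + k).+1)%N); last by lia.
by rewrite eM2_dstar dstar_weight_lt ?expR1_gt2.
Qed.

Lemma eM2_le n (e : rel 'I_n) (M : nat) : is_tree e ->
    (forall u v, e u v -> (deg e u * deg e v <= M)%N) ->
  eM2 R e <= n.-1%:R * expR 1 ^+ M.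
Proof.
move=> tree_e le_M.
have E_ge1 : 1 <= expR 1 :> R by rewrite ltW // (lt_trans _ expR1_gt2) ?ltr1n.
have E_ge0 : 0 <= expR 1 ^+ M :> R by rewrite exprn_ge0 ?expR_ge0.
rewrite -(ler_pMn2r (isT : 0 < 2)%N) eM2_double; last by case: tree_e.
apply: le_trans (_ : \sum_u \sum_(v | e u v) expR 1 ^+ M <= _).
  apply: ler_sum => u _; apply: ler_sum => v euv.
  by rewrite -[X in expR X]mulr1 expRM_natl ler_weXn2l ?le_M.
(* [tree_sum_in] is applied to the full vertex set, which must be nonempty. *)
have [n0|n_gt0] := posnP n.
  rewrite big1 ?mulrn_wge0 ?mulr_ge0 ?ler0n // => u.
  by have := ltn_ord u; rewrite {2}n0.
rewrite (eq_bigr (fun u => (deg e u)%:R * expR 1 ^+ M)) => [|u _]; last first.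
  by rewrite sumr_const mulr_natl /deg cardsE.
rewrite -mulr_suml -natr_sum -mulrnAl -mulrnA ler_wpM2r // ler_nat.
have set0T : [set: 'I_n] != set0 by rewrite -card_gt0 cardsT card_ord.
have := tree_sum_in tree_e set0T; rewrite cardsT card_ord -muln2.
congr (_ <= _)%N; apply: eq_big => [u|u _]; first by rewrite inE.
by rewrite degE; apply: eq_bigl => v; rewrite inE.
Qed.

Lemma eM2_lt_balanced_dstar n (e : rel 'I_n) : (4 <= n)%N -> is_tree e ->
    (forall u v, e u v -> (deg e u + deg e v < n)%N) ->
  eM2 R e < eM2 R (@dstar n (n - 2)./2).
Proof.
move=> n_ge4 tree_e lt_deg.
pose x := (n - 2)./2; pose y := (n - 2 - x)%N.
have n_xy : n = (x + y).+2 by rewrite /y /x; lia.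
have dstarE : eM2 R (@dstar n x) = dstar_weight (expR 1) x y.
  by rewrite -(eM2_dstar x y R) -n_xy.
(* The degrees sum to at most [n - 1 = (x + 1) + y], and these two summands differ by at most 1. *)
have le_M u v : e u v -> (deg e u * deg e v <= x.+1 * y)%N.
  by move=> /lt_deg deg_uv; apply: leq_mul_balanced; rewrite /y /x; lia.
apply: le_lt_trans (eM2_le tree_e le_M) _.
have x_gt0 : (0 < x)%N by rewrite /x; lia.
(* The central exponent [(x + 1) (y + 1)] leaves a spare factor [e^(x+1)] to pay for all edges:
   [n - 1 <= 2 (x + 1) <= 2^(x+1)]. The pendant terms then make the inequality strict. *)
have le_n : n.-1%:R <= expR 1 ^+ x.+1 :> R.
  apply: (ler_natr_expr expR1_gt2); apply: leq_trans (_ : (x.+1).*2 <= _)%N.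
    by rewrite n_xy /y /x; lia.
  by rewrite expnS mul2n leq_double ltn_expl.
rewrite dstarE /dstar_weight (mulnS x.+1 y) exprD.
have E_gt0 j : 0 < expR 1 ^+ j :> R by rewrite exprn_gt0 ?expR_gt0.
rewrite -addrA ltr_pwDr //; last first.
  by rewrite ler_wpM2r ?(ltW (E_gt0 _)).
by rewrite addr_gt0 ?mulr_gt0 ?ltr0n //; rewrite /y; lia.
Qed.

End Comparison.

(** * Improving every tree other than the balanced double star *)

Theorem theorem1 (R : realType) (n : nat) (T : rel 'I_n) :
  4 <= n -> is_tree T -> ~ graph_iso T (@dstar n ((n - 2)./2)) ->
  exists T2 : rel 'I_n, is_tree T2 /\ (eM2 R T < eM2 R T2)%R.
Proof.
move=> n_ge4 tree_T not_balanced.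
have dstar_tree x : x.+2 <= n -> is_tree (@dstar n x).
  by move=> x_lt; rewrite -(subnKC x_lt) !addSn; exact: dstar_is_tree.
have [deg_lt|] := boolP [forall u, forall v, T u v ==> (deg T u + deg T v < n)].
  exists (@dstar n (n - 2)./2); split; first by apply: dstar_tree; lia.
  apply: eM2_lt_balanced_dstar => // u v Tuv.
  by have /forallP/(_ u)/forallP/(_ v)/implyP/(_ Tuv) := deg_lt.
rewrite negb_forall => /existsP[u]; rewrite negb_forall => /existsP[v].
rewrite negb_imply -leqNgt => /andP[Tuv deg_ge].
have {deg_ge} deg_uv : deg T u + deg T v = n.
  by apply/eqP; rewrite eqn_leq deg_ge tree_deg_add_le.
have [[sym_T _] _] := tree_T.
(* Let [u] be the centre with fewer pendant vertices; their number is then at most the floor of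
   [(n - 2) / 2], and equality would make [T] balanced. *)
wlog deg_le : u v Tuv deg_uv / deg T u <= deg T v => [main|].
  have [le_uv|/ltnW le_vu] := leqP (deg T u) (deg T v); first exact: (main u v).
  have Tvu : T v u by rewrite sym_T.
  have deg_vu : deg T v + deg T u = n by rewrite addnC.
  exact: (main v u).
have deg_u : 0 < deg T u by rewrite card_gt0; apply/set0Pn; exists v; rewrite inE.
have iso_T := tree_spanning_dstar tree_T Tuv deg_uv.
have lt_x : (deg T u).-1 < (n - 2)./2.
  have neq_x : (deg T u).-1 != (n - 2)./2.
    by apply/eqP => eq_x; apply: not_balanced; rewrite -eq_x.
  by move: neq_x deg_u deg_le deg_uv; lia.
have tree_x : is_tree (@dstar n (deg T u).-1) by apply: dstar_tree; lia.
(* [T] has [deg T u - 1] pendant vertices at [u]; the better tree has one more. *)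
exists (@dstar n (deg T u)); split; first by apply: dstar_tree; lia.
rewrite (eM2_iso R (proj1 tree_T) (proj1 tree_x) iso_T).
by have := eM2_dstar_lt R lt_x; rewrite prednK.
Qed.
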